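(* Let $\{[\mathbb C(x;\mathcal S)],x\in\mathbb R^3\}$ be the non-Gaussian second-order random field $$[\mathbb C(x;\mathcal S)]=\frac{1}{1+\epsilon}[\underline{\mathbb L}]^T\big(\epsilon[I_6]+[C(x;\mathcal S)]\big)[\underline{\mathbb L}]$$ defined in the context. There is a second-order $\mathbb R^+$-valued random variable $\Gamma_{\mathbb C}$, independent of (i.e. not depending on) $x\in\mathbb R^3$ and $\mathcal S\in\mathcal C_{\mathcal S}$, with $$E\{\Gamma_{\mathbb C}^2\}<+\infty,\qquad E\{\Gamma_{\mathbb C}^4\}<+\infty,$$ such that for every $\mathcal S\in\mathcal C_{\mathcal S}$, every $\omega\in\mathbb R^6\setminus\{0\}$ and every $x\in\mathbb R^3$, $$\frac{\langle[\mathbb C(x;\mathcal S)]\omega,\omega\rangle_2}{\|\omega\|_2^2}\le\|[\mathbb C(x;\mathcal S)]\|_F\le\Gamma_{\mathbb C}\quad\text{a.s.}$$ Moreover, for all $\omega,\omega'\in\mathbb R^6$ and all $x\in\mathbb R^3$, $$|\langle[\mathbb C(x;\mathcal S)]\omega,\omega'\rangle_2|\le\Gamma_{\mathbb C}\,\|\omega\|_2\|\omega'\|_2\quad\text{a.s.},\qquad \langle[\mathbb C(x;\mathcal S)]\omega,\omega\rangle_2\ge\underline c_\epsilon\|\omega\|_2^2\quad\text{a.s.},$$ where $\underline c_\epsilon=\underline c_0\,\epsilon/(1+\epsilon)$ is a finite positive constant independent of $x$ and $\mathcal S$.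
   Context: Notation: $\mathbb M_6^+$ is the set of symmetric positive-definite real $6\times 6$ matrices; $\|\cdot\|_F$ is the Frobenius norm; $\langle\cdot,\cdot\rangle_2,\|\cdot\|_2$ are the Euclidean inner product and norm; $E$ is expectation on the probability space $(\Theta,\mathcal T,\mathcal P)$. Mean matrix. $[\underline{\mathbb C}]\in\mathbb M_6^+$ is a given matrix, independent of $x$ and $\mathcal S$, with $\operatorname{tr}[\underline{\mathbb C}]=\underline c_1$ and $\langle[\underline{\mathbb C}]\omega,\omega\rangle_2\ge\underline c_0\|\omega\|_2^2$ for all $\omega\in\mathbb R^6$, where $\underline c_0,\underline c_1$ are positive finite constants. $[\underline{\mathbb L}]$ is the upper triangular real $6\times6$ matrix with $[\underline{\mathbb C}]=[\underline{\mathbb L}]^T[\underline{\mathbb L}]$; $\epsilon>0$ is given. Spectral discretization. Let $\nu_s\ge 2$ be an even integer, $\nu=\nu_s^3$, $\widehat\nu_s=\nu_s/2$, $\mathcal B=\{1,\dots,\nu_s\}^3$, $\widehat{\mathcal B}=\{1,\dots,\widehat\nu_s\}^3\subset\mathcal B$. For $\beta=(\beta_1,\beta_2,\beta_3)\in\mathcal B$ let $\tau_\beta=(\tau_{\beta_1},\tau_{\beta_2},\tau_{\beta_3})$ with $\tau_{\beta_j}=-1+(\beta_j-\tfrac12)\tfrac{2}{\nu_s}$. Let $\chi:\mathbb R^3\to\mathbb R^+$ be continuous with compact support $[-1,1]^3$, $\int_{\mathbb R^3}\chi=1$, $\chi(-\tau)=\chi(\tau)$, and invariant under the change of sign of any one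 coordinate (quadrant symmetry). Put $\chi^\Delta_\beta=(2/\nu_s)^3\chi(\tau_\beta)$. The integer $\nu_s$ is fixed and large enough that $|\sum_{\beta\in\mathcal B}\chi^\Delta_\beta-1|\le\epsilon_s$ for a fixed small $\epsilon_s\in(0,1)$. Parameterization. $\mathcal C_y$ is the set of real $3\times\widehat\nu_s$ matrices with all entries in $[0,1]$; $[\underline y]\in\mathcal C_y$ has all entries $1/2$. For $\widehat\beta\in\widehat{\mathcal B}$, $a_{\widehat\beta}([y])=\sqrt{\chi^\Delta_{\widehat\beta}}\;q_{\widehat\beta}([y];\delta_s)$, where $\delta_s>0$ is fixed and $q_{\widehat\beta}(\cdot;\delta_s):\mathcal C_y\to\mathbb R$ is a given continuous function with $q_{\widehat\beta}([\underline y];\delta_s)=1$. This is extended to $\beta\in\mathcal B$ by quadrant symmetry: $a_\beta=a_{\widehat\beta}$ with $\widehat\beta_j=\min(\beta_j,\nu_s+1-\beta_j)$. It is assumed that $\sum_{\beta'\in\mathcal B}a_{\beta'}([y])^2>0$ for all $[y]\in\mathcal C_y$, and $\widetilde\chi^\Delta_\beta([y])=a_\beta([y])^2\big(\sum_{\beta'\in\mathcal B}a_{\beta'}([y])^2\big)^{-1}$. Let $\mathcal C_w=\prod_{j=1}^3[w_j^{\min},w_j^{\max}]$ with $0<w_j^{\min}<w_j^{\max}<+\infty$, and $\mathcal C_{\mathcal S}=\mathcal C_w\times\mathcal C_y$, with elements $\mathcal S=\{w,[y]\}$. Gaussian germs. For $z,\varphi\in\mathbb R^\nu$ indexed by $\mathcal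 B$, set $$g^\nu(x;\mathcal S,z,\varphi)=\sum_{\beta\in\mathcal B}\sqrt{2\widetilde\chi^\Delta_\beta([y])}\;z_\beta\cos\Big(\varphi_\beta+\sum_{j=1}^3\frac{\pi}{w_j}\tau_{\beta_j}x_j\Big).$$ Let $Z=(Z_\beta)_{\beta\in\mathcal B}$, $\Phi=(\Phi_\beta)_{\beta\in\mathcal B}$ consist of $2\nu$ independent random variables, with $Z_\beta=\sqrt{-\log\Psi_\beta}$, $\Psi_\beta$ uniform on $[0,1]$, $\Phi_\beta$ uniform on $[0,2\pi]$. Let $\{Z^{mn},\Phi^{mn}\}_{1\le m\le n\le 6}$ be $21$ independent copies of $(Z,\Phi)$ on $(\Theta,\mathcal T,\mathcal P)$ and $G^\nu_{mn}(x;\mathcal S)=g^\nu(x;\mathcal S,Z^{mn},\Phi^{mn})$. Random field $[C]$. Fix $\delta_c\in\,]0,\sqrt{7/11}[$, $\sigma_c=\delta_c/\sqrt7$, $\alpha_m=\frac{1}{2\sigma_c^2}+\frac{1-m}{2}$ for $m=1,\dots,6$ (so $\alpha_m>3$). For $\alpha>3$, $b\in\mathbb R$, $h(b;\alpha)=F_\alpha^{-1}(F(b))$, where $F$ is the standard normal c.d.f. and $F_\alpha(\gamma)=\Gamma(\alpha)^{-1}\int_0^\gamma t^{\alpha-1}e^{-t}dt$. Then $[C(x;\mathcal S)]=[L(x;\mathcal S)]^T[L(x;\mathcal S)]$ with $[L(x;\mathcal S)]$ upper triangular $6\times 6$, $[L(x;\mathcal S)]_{mn}=\sigma_c G^\nu_{mn}(x;\mathcal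 S)$ for $m<n$ and $[L(x;\mathcal S)]_{mm}=\sigma_c\sqrt{2\,h(G^\nu_{mm}(x;\mathcal S);\alpha_m)}$. *)

(* Defs.v *)
From HB Require Import structures.
From mathcomp Require Import all_boot all_order all_algebra.
From mathcomp Require Import all_classical all_reals all_analysis.

Set Implicit Arguments.
Unset Strict Implicit.
Unset Printing Implicit Defensive.

Import Order.TTheory GRing.Theory Num.Theory.
Import numFieldNormedType.Exports.

Local Open Scope classical_set_scope.
Local Open Scope ring_scope.

(* The norm [`|A|] of the library on matrices and vectors is the sup norm,
   hence the explicit Euclidean and Frobenius norms. *)
Definition inner2 (R : realType) n (u v : 'cV[R]_n) : R :=
  \sum_i u i 0 * v i 0.
Definition norm2 (R : realType) n (u : 'cV[R]_n) : R := Num.sqrt (inner2 u u).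
Definition normF (R : realType) m n (A : 'M[R]_(m, n)) : R :=
  Num.sqrt (\sum_i \sum_j A i j ^+ 2).

Definition sym_posdef (R : realType) n (A : 'M[R]_n) : Prop :=
  A^T = A /\ forall w : 'cV[R]_n, w != 0 -> 0 < inner2 (A *m w) w.

(* [is_trig_mx] means lower triangular. *)
Definition upper_trig (R : realType) n (A : 'M[R]_n) : Prop := is_trig_mx A^T.

(* Multi-indices are 0-based: the component [i : 'I_n] stands for the index
   [i + 1] in {1, ..., n}. *)
Definition mindex (n : nat) := {ffun 'I_3 -> 'I_n}.

(* The even integer nu_s >= 2 is [k.*2] with [0 < k], k being nu_s / 2. *)
Lemma half_leq_double k : (k <= k.*2)%N.
Proof. by rewrite -addnn leq_addr. Qed.

Lemma fold_subproof k (i : 'I_(k.*2)) : (minn i (k.*2.-1 - i) < k)%N.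
Proof.
case: i => i /= i2k; rewrite gtn_min; case: (ltnP i k) => //= ki.
have k0 : (0 < k)%N by case: (k) i2k.
rewrite ltn_subLR -ltnS prednK ?double_gt0 // -addnn -?addSn.
by rewrite ltn_add2r.
Qed.

(* 0-based form of b |-> min(b, nu_s + 1 - b). *)
Definition fold_ord k (i : 'I_(k.*2)) : 'I_k := Ordinal (fold_subproof i).
Definition fold_index k (b : mindex k.*2) : mindex k :=
  [ffun j => fold_ord (b j)].
Definition incl_index k (b : mindex k) : mindex k.*2 :=
  [ffun j => widen_ord (half_leq_double k) (b j)].

Section SpectralDiscretization.
Variable R : realType.

Definition cube3 : set 'rV[R]_3 := [set t | forall j, -1 <= t 0 j <= 1].
Definition row3 (a b c : R) : 'rV[R]_3 := \row_(j < 3) [:: a; b; c]`_j.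
Definition flip_sign (j : 'I_3) (t : 'rV[R]_3) : 'rV[R]_3 :=
  \row_k (if k == j then - t 0 k else t 0 k).

Definition integral3 (f : 'rV[R]_3 -> R) : \bar R :=
  (\int[(@lebesgue_measure R \x @lebesgue_measure R) \x @lebesgue_measure R]_p
    (f (row3 p.1.1 p.1.2 p.2))%:E)%E.

Definition spectral_density (chi : 'rV[R]_3 -> R) : Prop :=
  [/\ continuous chi,
      forall t, 0 <= chi t,
      closure [set t | chi t != 0] = cube3,
      integral3 chi = 1%:E &
      (forall t, chi (- t) = chi t) /\
      (forall j t, chi (flip_sign j t) = chi t)].

Definition tau1 (n : nat) (i : 'I_n) : R :=
  -1 + ((i.+1)%:R - 2^-1) * (2 / n%:R).
Definition tau n (b : mindex n) : 'rV[R]_3 := \row_j tau1 (b j).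

Definition chiD (chi : 'rV[R]_3 -> R) n (b : mindex n) : R :=
  (2 / n%:R) ^+ 3 * chi (tau b).

Definition Cy k : set 'M[R]_(3, k) := [set y | forall i j, 0 <= y i j <= 1].
Definition ymid k : 'M[R]_(3, k) := const_mx 2^-1.

Definition Cw (wmin wmax : 'rV[R]_3) : set 'rV[R]_3 :=
  [set w | forall j, wmin 0 j <= w 0 j <= wmax 0 j].

Definition CS k (wmin wmax : 'rV[R]_3) : set ('rV[R]_3 * 'M[R]_(3, k)) :=
  Cw wmin wmax `*` @Cy k.

Section Parameterization.
Variables (k : nat) (chi : 'rV[R]_3 -> R) (q : mindex k -> 'M[R]_(3, k) -> R).

Definition ampl_half (b : mindex k) (y : 'M[R]_(3, k)) : R :=
  Num.sqrt (chiD chi (incl_index b)) * q b y.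
Definition ampl (b : mindex k.*2) (y : 'M[R]_(3, k)) : R :=
  ampl_half (fold_index b) y.
Definition ampl_sqsum (y : 'M[R]_(3, k)) : R :=
  \sum_(b : mindex k.*2) ampl b y ^+ 2.
Definition chiDt (b : mindex k.*2) (y : 'M[R]_(3, k)) : R :=
  ampl b y ^+ 2 * (ampl_sqsum y)^-1.

Definition gnu (x : 'rV[R]_3) (S : 'rV[R]_3 * 'M[R]_(3, k))
    (z phi : mindex k.*2 -> R) : R :=
  \sum_(b : mindex k.*2) Num.sqrt (2 * chiDt b S.2) * z b *
    cos (phi b + \sum_(j < 3) pi / S.1 0 j * tau1 (b j) * x 0 j).

End Parameterization.
End SpectralDiscretization.

Section Distributions.
Variable R : realType.

Definition std_normal_cdf (b : R) : R :=
  fine (normal_prob (0 : R) 1 `]-oo, b]).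

Definition gamma_fun (a : R) : R :=
  \int[@lebesgue_measure R]_(t in `[0, +oo[) (t `^ (a - 1) * expR (- t)).
Definition gamma_cdf (a c : R) : R :=
  (gamma_fun a)^-1 *
  \int[@lebesgue_measure R]_(t in `[0, c]) (t `^ (a - 1) * expR (- t)).
(* Inverse of the restriction of [gamma_cdf a] to [0, +oo[. *)
Definition gamma_quantile (a : R) : R -> R :=
  'pinv_(fun=> 0) `[0, +oo[ (gamma_cdf a).
Definition hfun (b a : R) : R := gamma_quantile a (std_normal_cdf b).

Lemma two_pi_gt0 : 0 < 2 * pi :> R.
Proof. by rewrite mulr_gt0 // pi_gt0. Qed.

Definition uniform_phase : set R -> \bar R := uniform_prob two_pi_gt0.
(* Law of sqrt(- log Psi) with Psi uniform on [0, 1]. *)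
Definition amplitude_law (A : set R) : \bar R :=
  uniform_prob (@ltr01 R) ((fun u : R => Num.sqrt (- ln u)) @^-1` A).

End Distributions.

Section RandomVariables.
Context d (T : measurableType d) (R : realType) (P : probability T R).

(* Laws are compared on measurable sets only: a measure is a total function on
   [set T], arbitrary outside the sigma-algebra. *)
Definition has_law (X : {RV P >-> R}) (mu : set R -> \bar R) : Prop :=
  forall A, measurable A -> distribution P X A = mu A.

(* Mutual independence of the subfamily of X indexed by D. *)
Definition mutually_independent (I : finType) (D : {set I})
    (X : I -> {RV P >-> R}) : Prop :=
  forall J : {set I}, J \subset D ->
  forall A : I -> set R, (forall i, measurable (A i)) ->
  P (\bigcap_(i in [set` J]) (X i @^-1` A i)) =
  (\prod_(i in J) P (X i @^-1` A i))%E.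

(* 21 independent copies, indexed by m <= n, of (Z, Phi), itself made of
   independent components: all the variables with m <= n are independent and
   have the prescribed laws. The variables with m > n are unconstrained and
   play no role. *)
Definition germ_variables k
    (Z Phi : 'I_6 -> 'I_6 -> mindex k.*2 -> {RV P >-> R}) : Prop :=
  [/\ forall (m n : 'I_6) b, (m <= n)%N -> has_law (Z m n b) (@amplitude_law R),
      forall (m n : 'I_6) b, (m <= n)%N -> has_law (Phi m n b) (@uniform_phase R) &
      mutually_independent
        [set i : 'I_6 * 'I_6 * bool * mindex k.*2 |
           (i.1.1.1 <= i.1.1.2)%N]
        (fun i => let: (m, n, isZ, b) := i in
           if isZ then Z m n b else Phi m n b)].

Definition Gnu k (chi : 'rV[R]_3 -> R) (q : mindex k -> 'M[R]_(3, k) -> R)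
    (Z Phi : 'I_6 -> 'I_6 -> mindex k.*2 -> {RV P >-> R})
    (x : 'rV[R]_3) (S : 'rV[R]_3 * 'M[R]_(3, k)) (t : T) (m n : 'I_6) : R :=
  gnu chi q x S (fun b => Z m n b t) (fun b => Phi m n b t).

End RandomVariables.

Section ElasticityField.
Variable R : realType.

Definition sigmac (delta : R) : R := delta / Num.sqrt 7.
(* The 0-based [m : 'I_6] stands for the index m + 1. *)
Definition alphac (delta : R) (m : 'I_6) : R :=
  1 / (2 * sigmac delta ^+ 2) + (1 - (m.+1)%:R) / 2.

Definition Lmat (delta : R) (G : 'I_6 -> 'I_6 -> R) : 'M[R]_6 :=
  \matrix_(m < 6, n < 6)
    if (m < n)%N then sigmac delta * G m n
    else if m == n then
      sigmac delta * Num.sqrt (2 * hfun (G m m) (alphac delta m))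
    else 0.
Definition Cmat (delta : R) (G : 'I_6 -> 'I_6 -> R) : 'M[R]_6 :=
  (Lmat delta G)^T *m Lmat delta G.

Definition elasticity (eps : R) (Lbar C : 'M[R]_6) : 'M[R]_6 :=
  (1 / (1 + eps)) *: (Lbar^T *m (eps *: 1%:M + C) *m Lbar).

End ElasticityField.

Definition elasticity_field d (T : measurableType d) (R : realType)
    (P : probability T R) k (chi : 'rV[R]_3 -> R)
    (q : mindex k -> 'M[R]_(3, k) -> R)
    (Z Phi : 'I_6 -> 'I_6 -> mindex k.*2 -> {RV P >-> R})
    (delta eps : R) (Lbar : 'M[R]_6)
    (x : 'rV[R]_3) (S : 'rV[R]_3 * 'M[R]_(3, k)) (t : T) : 'M[R]_6 :=
  elasticity eps Lbar (Cmat delta (Gnu chi q Z Phi x S t)).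

(* Main.v *)
Require Import Defs.
From HB Require Import structures.
From mathcomp Require Import all_boot all_order all_algebra.
From mathcomp Require Import all_classical all_reals all_analysis.
From mathcomp Require Import measurable_realfun ring lra.

Set Implicit Arguments.
Unset Strict Implicit.
Unset Printing Implicit Defensive.

Import Order.TTheory GRing.Theory Num.Theory.
Import numFieldNormedType.Exports.

Local Open Scope classical_set_scope.
Local Open Scope ring_scope.

(** The field is dominated pointwise, for every outcome, by an affine function
of one random variable that sees neither [x] nor [S]: the energy
[germ_energy], the sum of the squared amplitudes [Z m n b] over [m <= n] and
all [b].

- Germs. The normalized weights [chiDt] add up to 1 and cosines are at most 1,
  so Cauchy-Schwarz bounds the square of a germ by twice the sum of its
  squared amplitudes ([sqr_gnu_le]). All dependence on [x], [S] and the
  phases disappears at this step.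

- Triangular factor. Above the diagonal its entries are multiples of germs. On
  the diagonal they involve [hfun], the gamma quantile of a Gaussian
  probability, which grows at most quadratically ([hfun_le]): the upper tail
  of the normal law is at least of order [exp (- b ^ 2)], that of the gamma
  law at most of order [exp (- g / 2)], hence equal tails force [g] below
  [2 * b ^ 2] plus a constant. So the squared Frobenius norm of the factor is
  affine in the energy ([sqr_normF_Lmat_le]), and submultiplicativity carries
  this to the elasticity matrix ([normF_elasticity_le]).

- Moments. A squared amplitude is exponentially distributed, being [- ln u]
  for a uniform [u]. As [(- ln u) ^ 4] is bounded by a multiple of
  [u ^ (- 1 / 2)], which is integrable on ]0, 1], it lies in L^4
  ([amplitude_sqr_Lfun4]), and so do the energy and the dominating variable;
  L^2 follows, the measure being finite.

- Lower bound. The random part of the matrix is a Gram matrix, hence adds a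
  nonnegative term to the quadratic form of the mean part
  ([elasticity_coercive]). *)

(** * Frobenius norm *)

(** Lagrange's identity: twice the defect is the sum over all pairs of the
squared minors [(a i * b j - a j * b i) ^+ 2]. *)
Lemma cauchy_schwarz_sum (R : realType) (I : finType) (a b : I -> R) :
  (\sum_i a i * b i) ^+ 2 <= (\sum_i a i ^+ 2) * (\sum_i b i ^+ 2).
Proof.
have lagrange : \sum_i \sum_j (a i * b j - a j * b i) ^+ 2 =
    2 * ((\sum_i a i ^+ 2) * (\sum_i b i ^+ 2) - (\sum_i a i * b i) ^+ 2).
  have prodE (f g : I -> R) :
      (\sum_i f i) * (\sum_j g j) = \sum_i \sum_j f i * g j.
    by rewrite mulr_suml; apply: eq_bigr => i _; rewrite mulr_sumr.
  set A := \sum_i a i ^+ 2; set B := \sum_i b i ^+ 2.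
  set C := \sum_i a i * b i.
  have -> : 2 * (A * B - C ^+ 2) = A * B + B * A - 2 * (C * C) by ring.
  rewrite !prodE mulr_sumr -big_split -sumrB; apply: eq_bigr => i _.
  rewrite mulr_sumr -big_split -sumrB; apply: eq_bigr => j _ /=.
  by ring.
rewrite -subr_ge0 -(pmulr_rge0 _ (ltr0n R 2)) -lagrange.
by apply: sumr_ge0 => i _; apply: sumr_ge0 => j _; exact: sqr_ge0.
Qed.

Section FrobeniusNorm.
Context (R : realType).

Lemma normF_ge0 m n (A : 'M[R]_(m, n)) : 0 <= normF A.
Proof. exact: sqrtr_ge0. Qed.

Lemma sqr_normF m n (A : 'M[R]_(m, n)) :
  normF A ^+ 2 = \sum_i \sum_j A i j ^+ 2.
Proof.
rewrite sqr_sqrtr// sumr_ge0// => i _.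
by rewrite sumr_ge0// => j _; exact: sqr_ge0.
Qed.

Lemma norm2E n (u : 'cV[R]_n) : norm2 u = normF u.
Proof.
by congr Num.sqrt; apply: eq_bigr => i _; rewrite big_ord1 expr2.
Qed.

Lemma normF_tr m n (A : 'M[R]_(m, n)) : normF A^T = normF A.
Proof.
rewrite /normF exchange_big; congr Num.sqrt; apply: eq_bigr => i _.
by apply: eq_bigr => j _; rewrite mxE.
Qed.

Lemma normFZ m n c (A : 'M[R]_(m, n)) : 0 <= c -> normF (c *: A) = c * normF A.
Proof.
move=> c0; apply: (pexpIrn (n := 2)) => //;
  rewrite ?nnegrE ?mulr_ge0 ?normF_ge0// exprMn !sqr_normF mulr_sumr.
apply: eq_bigr => i _; rewrite mulr_sumr.
by apply: eq_bigr => j _; rewrite mxE exprMn.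
Qed.

Lemma normF_mul m n p (A : 'M[R]_(m, n)) (B : 'M[R]_(n, p)) :
  normF (A *m B) <= normF A * normF B.
Proof.
rewrite -(ler_pXn2r (n := 2)) ?nnegrE ?mulr_ge0 ?normF_ge0//.
rewrite exprMn !sqr_normF mulr_suml; apply: ler_sum => i _.
rewrite (exchange_big _ _ _ _ _ (fun i j => B i j ^+ 2)) mulr_sumr.
apply: ler_sum => j _; rewrite mxE.
exact: (cauchy_schwarz_sum (A i) (B^~ j)).
Qed.

Lemma normF_triangle m n (A B : 'M[R]_(m, n)) :
  normF (A + B) <= normF A + normF B.
Proof.
have cs : \sum_i \sum_j A i j * B i j <= normF A * normF B.
  apply: le_trans (ler_norm _) _.
  rewrite -(ler_pXn2r (n := 2)) ?nnegrE ?mulr_ge0 ?normF_ge0//.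
  rewrite real_normK ?num_real// exprMn !sqr_normF !pair_big.
  exact: (cauchy_schwarz_sum (fun p => A p.1 p.2) (fun p => B p.1 p.2)).
rewrite -(ler_pXn2r (n := 2)) ?nnegrE ?addr_ge0 ?normF_ge0// sqrrD.
have -> : normF (A + B) ^+ 2 =
    normF A ^+ 2 + (\sum_i \sum_j A i j * B i j) *+ 2 + normF B ^+ 2.
  rewrite !sqr_normF -sumrMnl -!big_split; apply: eq_bigr => i _.
  rewrite /= -sumrMnl -!big_split; apply: eq_bigr => j _ /=.
  by rewrite mxE sqrrD.
by rewrite lerD2r lerD2l lerMn2r cs orbT.
Qed.

Lemma inner2_le n (u v : 'cV[R]_n) : `| inner2 u v | <= norm2 u * norm2 v.
Proof.
rewrite -(ler_pXn2r (n := 2)) ?nnegrE ?mulr_ge0 ?norm2E ?normF_ge0//.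
rewrite real_normK ?num_real// exprMn !sqr_normF.
under [X in _ <= X * _]eq_bigr do rewrite big_ord1.
under [X in _ <= _ * X]eq_bigr do rewrite big_ord1.
exact: (cauchy_schwarz_sum (u^~ 0) (v^~ 0)).
Qed.

Lemma inner2_mulmx_le n (A : 'M[R]_n) (u v : 'cV[R]_n) :
  `| inner2 (A *m u) v | <= normF A * norm2 u * norm2 v.
Proof.
apply: le_trans (inner2_le _ _) _; rewrite ler_wpM2r ?norm2E ?normF_ge0//.
exact: normF_mul.
Qed.

Lemma inner2Dl n (u v w : 'cV[R]_n) :
  inner2 (u + v) w = inner2 u w + inner2 v w.
Proof.
by rewrite /inner2 -big_split; apply: eq_bigr => i _; rewrite mxE mulrDl.
Qed.

Lemma inner2Zl n c (u w : 'cV[R]_n) : inner2 (c *: u) w = c * inner2 u w.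
Proof.
by rewrite /inner2 mulr_sumr; apply: eq_bigr => i _; rewrite mxE mulrA.
Qed.

Lemma sqr_norm2 n (u : 'cV[R]_n) : norm2 u ^+ 2 = inner2 u u.
Proof.
by rewrite norm2E sqr_normF; apply: eq_bigr => i _; rewrite big_ord1.
Qed.

Lemma norm2_gt0 n (u : 'cV[R]_n) : u != 0 -> 0 < norm2 u.
Proof.
move=> u0; rewrite norm2E lt_neqAle normF_ge0 andbT eq_sym.
apply: contra_neqN u0 => /eqP n0; apply/matrixP => i j; rewrite mxE.
have /eqP := sqr_normF u; rewrite n0 expr0n/= eq_sym psumr_eq0; last first.
  by move=> k _; rewrite sumr_ge0// => l _; exact: sqr_ge0.
move=> /allP/(_ i); rewrite mem_index_enum => /(_ isT)/=.
rewrite psumr_eq0 => [/allP/(_ j)|l _]; last exact: sqr_ge0.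
by rewrite mem_index_enum => /(_ isT)/=; rewrite sqrf_eq0 => /eqP.
Qed.

Lemma inner2_gram m n (M : 'M[R]_(m, n)) (w : 'cV[R]_n) :
  inner2 (M^T *m M *m w) w = norm2 (M *m w) ^+ 2.
Proof.
have inner2E p (u v : 'cV[R]_p) : inner2 u v = (u^T *m v) 0 0.
  by rewrite mxE; apply: eq_bigr => i _; rewrite mxE.
by rewrite sqr_norm2 !inner2E !trmx_mul trmxK !mulmxA.
Qed.

End FrobeniusNorm.

(** * Bounds on the elasticity matrix in terms of its triangular factor *)

Section Elasticity.
Context (R : realType) (eps : R) (Lbar : 'M[R]_6).
Hypothesis eps_gt0 : 0 < eps.

(** The quadratic form splits into [eps] times that of the mean matrix and
[norm2 (L *m Lbar *m w) ^+ 2], which is nonnegative. *)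
Lemma elasticity_coercive (c0 : R) (L : 'M[R]_6) (w : 'cV[R]_6) :
  c0 * norm2 w ^+ 2 <= inner2 (Lbar^T *m Lbar *m w) w ->
  c0 * (eps / (1 + eps)) * norm2 w ^+ 2 <=
    inner2 (elasticity eps Lbar (L^T *m L) *m w) w.
Proof.
move=> coer.
have -> : inner2 (elasticity eps Lbar (L^T *m L) *m w) w =
    (1 + eps)^-1 * (eps * inner2 (Lbar^T *m Lbar *m w) w +
      inner2 ((L *m Lbar)^T *m (L *m Lbar) *m w) w).
  rewrite /elasticity div1r mulmxDr mulmxDl -scalemxAr mulmx1.
  rewrite trmx_mul !mulmxA -!scalemxAl mulmxDl -scalemxAl.
  by rewrite inner2Zl inner2Dl inner2Zl.
have -> : c0 * (eps / (1 + eps)) * norm2 w ^+ 2 =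
    (1 + eps)^-1 * (eps * (c0 * norm2 w ^+ 2)) by ring.
rewrite ler_wpM2l//; first by rewrite invr_ge0 addr_ge0// ltW.
rewrite (le_trans (ler_wpM2l (ltW eps_gt0) coer))// lerDl inner2_gram.
exact: sqr_ge0.
Qed.

(** The factor [1 / (1 + eps)] is bounded by 1, which leaves a bound affine in
[normF L ^+ 2]. *)
Lemma normF_elasticity_le (L : 'M[R]_6) :
  normF (elasticity eps Lbar (L^T *m L)) <=
    normF Lbar ^+ 2 * (eps * normF (1%:M : 'M[R]_6) + normF L ^+ 2).
Proof.
have eps_ge0 := ltW eps_gt0.
rewrite /elasticity normFZ ?divr_ge0 ?addr_ge0//.
have n0 := @normF_ge0 R 6 6.
apply: (@le_trans _ _ (normF (Lbar^T *m (eps *: 1%:M + L^T *m L) *m Lbar))).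
  by rewrite ler_piMl// ler_pdivrMr ?mul1r ?lerDl ?ltW// addr_gt0.
rewrite (le_trans (normF_mul _ _))// expr2 mulrAC ler_wpM2r//.
rewrite (le_trans (normF_mul _ _))// normF_tr ler_wpM2l//.
rewrite (le_trans (normF_triangle _ _))// normFZ// lerD2l.
by rewrite (le_trans (normF_mul _ _))// normF_tr expr2.
Qed.

End Elasticity.
(** * Quadratic growth of the gamma quantile of a Gaussian probability *)

Section GammaQuantileGrowth.
Context (R : realType).
Local Notation mu := (@lebesgue_measure R).

(** Gives the lower bound of the normal tail and the positivity of the gamma
function: both integrands stay away from 0 on an interval of length 1. *)
Lemma le_Rintegral_unit_itv (D : set R) (f : R -> R) (b c : R) :
  measurable D -> mu.-integrable D (EFin \o f) -> `]b, b + 1] `<=` D ->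
  (forall x, D x -> 0 <= f x) -> 0 <= c ->
  (forall x, b < x <= b + 1 -> c <= f x) ->
  c <= \int[mu]_(x in D) f x.
Proof.
move=> mD intf subD f0 c0 cf.
have mf := measurable_int _ intf.
rewrite -lee_fin fineK; last exact: integrable_fin_num.
have -> : c%:E = (\int[mu]_(x in `]b, (b + 1)%R]) (cst c%:E x))%E.
  by rewrite integral_cst//= lebesgue_measure_itv/= lte_fin ltrDl ltr01 -EFinD
     addrAC subrr add0r mule1.
apply: (@le_trans _ _ (\int[mu]_(x in `]b, (b + 1)%R]) (f x)%:E)%E).
  apply: ge0_le_integral => //=.
  exact: measurable_funS mf.
by apply: ge0_subset_integral => //= x Dx; rewrite lee_fin f0.
Qed.

(** On the interval from [b] to [b + 1] the density is at least its value at a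
point whose square is [2 * b ^+ 2 + 2]. *)
Lemma std_normal_tail_ge (b : R) :
  normal_peak 1 * expR (- (b ^+ 2 + 1)) <= 1 - std_normal_cdf b.
Proof.
have -> : 1 - std_normal_cdf b =
    \int[mu]_(x in `]b, +oo[) normal_pdf 0 1 x.
  have PE := probability_setC (normal_prob (0 : R) 1)
    (measurable_itv `]-oo, b]).
  rewrite setCitvl in PE.
  rewrite /Rintegral -/(normal_prob 0 1 `]b, +oo[) PE fineB//.
  exact: fin_num_measure.
apply: (@le_Rintegral_unit_itv _ _ b) => //.
- by apply: integrableS (integrable_normal_pdf 0 1).
- by apply: subset_itvl.
- by move=> x _; exact: normal_pdf_ge0.
- by rewrite mulr_ge0 ?normal_peak_ge0 ?expR_ge0.
move=> x /andP[bx xb].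
rewrite normal_pdfE ?oner_eq0// ler_wpM2l ?normal_peak_ge0//.
rewrite /normal_fun ler_expR subr0 expr1n mulNr lerN2 ler_pdivrMr//.
(* [2 * b ^+ 2 + 2 - x ^+ 2] is [(b - (x - b)) ^+ 2 + 2 * (1 - (x - b) ^+ 2)] *)
have u1 : (x - b) ^+ 2 <= 1 by rewrite expr_le1// ?subr_ge0; lra.
have := sqr_ge0 (b - (x - b)); lra.
Qed.

Definition gamma_integrand (a t : R) : R := t `^ (a - 1) * expR (- t).

(** The [p]-th power of [t / (2 * p) <= expR (t / (2 * p))]. *)
Lemma powR_le_expR (p t : R) : 0 < p -> 0 <= t ->
  t `^ p <= (2 * p) `^ p * expR (t / 2).
Proof.
move=> p0 t0.
have p20 : 0 < 2 * p by rewrite mulr_gt0.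
have -> : expR (t / 2) = expR (t / (2 * p)) `^ p.
  by rewrite -expRM; congr expR; field; rewrite gt_eqF.
have p_ge0 := ltW p0; have p2_ge0 := ltW p20; rewrite -powRM ?expR_ge0//.
apply: ge0_ler_powR; rewrite ?nnegrE ?mulr_ge0 ?expR_ge0//.
rewrite mulrC -ler_pdivrMr//; apply: ltW.
rewrite (lt_le_trans _ (expR_ge1Dx _))//.
by rewrite ltrDr ltr01.
Qed.

(** Half of the exponential decay absorbs the power of [t]; what remains is a
multiple of the exponential density of rate [1 / 2], whose integrals are
explicit. *)
Lemma gamma_integrand_le (a t : R) : 1 < a -> 0 <= t ->
  gamma_integrand a t <=
    2 * (2 * (a - 1)) `^ (a - 1) * exponential_pdf 2^-1 t.
Proof.
move=> a1 t0; rewrite /gamma_integrand.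
apply: (le_trans (ler_wpM2r (expR_ge0 _) (powR_le_expR _ t0))).
  by rewrite subr_gt0.
rewrite exponential_pdfE// -[leLHS]mulrA -expRD.
have -> : t / 2 - t = - 2^-1 * t by field.
by rewrite le_eqVlt; apply/orP; left; apply/eqP; field.
Qed.

Lemma measurable_gamma_integrand (a : R) (D : set R) :
  measurable_fun D (gamma_integrand a).
Proof.
apply: measurable_funTS; apply: measurable_funM; first exact: measurable_powR.
exact: measurableT_comp.
Qed.

Lemma gamma_integrand_ge0 (a t : R) : 0 <= gamma_integrand a t.
Proof. by rewrite mulr_ge0 ?powR_ge0 ?expR_ge0. Qed.

Lemma integrable_gamma_integrand (a : R) : 1 < a ->
  mu.-integrable `[0, +oo[ (EFin \o gamma_integrand a).
Proof.
move=> a1; pose K := 2 * (2 * (a - 1)) `^ (a - 1).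
have half0 : 0 < 2^-1 :> R by rewrite invr_gt0.
apply: (@le_integrable _ _ _ mu _ (measurable_itv _) _
  (fun t => K%:E * (exponential_pdf 2^-1 t)%:E)%E) => //.
- by apply/measurable_EFinP; exact: measurable_gamma_integrand.
- move=> t /=; rewrite in_itv/= andbT => t0.
  rewrite !lee_fin ger0_norm ?gamma_integrand_ge0// (le_trans _ (ler_norm _))//.
  exact: gamma_integrand_le.
- apply: integrableZl => //.
  exact: integrableS (integrable_exponential_pdf half0).
Qed.

Lemma gamma_tail_le (a g : R) : 1 < a -> 0 < g ->
  \int[mu]_(t in `]g, +oo[) gamma_integrand a t <=
    2 * (2 * (a - 1)) `^ (a - 1) * expR (- g / 2).
Proof.
move=> a1 g0; set K := 2 * _.
have half0 : 0 < 2^-1 :> R by rewrite invr_gt0.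
have sub : `]g, +oo[ `<=` `[0, +oo[.
  by apply: subset_itvr; rewrite bnd_simp ltW.
have intE D : measurable D ->
    mu.-integrable D (EFin \o exponential_pdf (2^-1 : R)).
  by move=> mD; exact: integrableS (integrable_exponential_pdf half0).
have -> : K * expR (- g / 2) =
    \int[mu]_(t in `]g, +oo[) (K * exponential_pdf 2^-1 t).
  rewrite RintegralZl//; last exact: intE.
  congr (K * _).
  rewrite -(@Rintegral_itvB _ _ (BLeft 0) (BInfty _ false) g); last 3 first.
  - exact: intE.
  - by rewrite bnd_simp ltW.
  - by rewrite bnd_simp.
  have -> : \int[mu]_(t in `[0, g]) exponential_pdf 2^-1 t =
      1 - expR (- 2^-1 * g).
    rewrite /Rintegral -/(exponential_prob 2^-1 `[0, g]).
    by rewrite exponential_prob_itv0c.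
  have -> : \int[mu]_(t in `[0, +oo[) exponential_pdf 2^-1 t = 1.
    transitivity (\int[mu]_t exponential_pdf 2^-1 t); last first.
      by rewrite /Rintegral integral_exponential_pdf.
    rewrite [LHS]Rintegral_mkcond; apply: eq_Rintegral => t _.
    rewrite patchE; case: ifPn => // /negP t0.
    by rewrite /exponential_pdf patchE ifF//; exact/negP.
  by rewrite opprB addrCA subrr addr0; congr expR; field.
apply: le_Rintegral => //.
- exact: integrableS (integrable_gamma_integrand a1).
- exact: (integrableZl _ K (intE _ _)).
- move=> t /sub; rewrite /= in_itv/= andbT; exact: gamma_integrand_le.
Qed.

(** Between 1 and 2 the power is at least 1 and the exponential at least
[expR (- 2)]. *)
Lemma gamma_fun_gt0 (a : R) : 1 < a -> 0 < gamma_fun a.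
Proof.
move=> a1; apply: (@lt_le_trans _ _ (expR (- 2))); first exact: expR_gt0.
apply: (@le_Rintegral_unit_itv _ _ 1) => //.
- exact: integrable_gamma_integrand.
- by move=> x /=; rewrite !in_itv/= andbT => /andP[/ltW + _]; apply: le_trans.
- by move=> x _; exact: gamma_integrand_ge0.
- move=> x /andP[x1 x2]; rewrite -[leLHS]mul1r ler_pM ?expR_ge0//.
    by rewrite -[leLHS](powRr0 x) ler_powR// ?subr_ge0 ltW.
  by rewrite ler_expR lerN2.
Qed.

Lemma gamma_cdf_tail_le (a g : R) : 1 < a -> 0 < g ->
  1 - gamma_cdf a g <=
    (gamma_fun a)^-1 * (2 * (2 * (a - 1)) `^ (a - 1)) * expR (- g / 2).
Proof.
move=> a1 g0; have G0 := gamma_fun_gt0 a1.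
rewrite -mulrA -ler_pdivrMl ?invr_gt0// invrK mulrBr mulr1.
rewrite /gamma_cdf mulVKf ?gt_eqF//.
apply: le_trans (gamma_tail_le a1 g0); rewrite le_eqVlt; apply/orP; left.
apply/eqP; apply: Rintegral_itvB; rewrite ?bnd_simp ?ltW//.
exact: integrable_gamma_integrand.
Qed.

(** A partial inverse takes its default value off the image, so that
[gamma_quantile] is either 0 or a genuine preimage. *)
Lemma pinv_cases (T U : Type) (dflt : U -> T) (A : set T) (f : T -> U) (y : U) :
  'pinv_dflt A f y = dflt y \/
  A ('pinv_dflt A f y) /\ f ('pinv_dflt A f y) = y.
Proof.
rewrite /pinv_ splitV oinv_surj; case: pselect => [fAy|_] /=; last by left.
by right; case: cid2.
Qed.

(** With [h := hfun b a] nonzero, the tails of the two laws agree: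
[normal_peak 1 * expR (- (b ^+ 2 + 1)) <= G * expR (- h / 2)]. Dividing and
using [1 + t <= expR t] makes the comparison linear in [h]. *)
Lemma hfun_le (a : R) : 1 < a ->
  exists2 K, 0 <= K & forall b, hfun b a <= 2 * b ^+ 2 + K.
Proof.
move=> a1; set G := (gamma_fun a)^-1 * (2 * (2 * (a - 1)) `^ (a - 1)).
have G0 : 0 <= G.
  by rewrite mulr_ge0 ?mulr_ge0 ?invr_ge0 ?powR_ge0// ltW// gamma_fun_gt0.
have peak0 : 0 < normal_peak (1 : R) := normal_peak_gt0 (oner_neq0 R).
have Gpeak0 : 0 <= G / normal_peak 1 by rewrite divr_ge0// ltW.
exists (2 * (G / normal_peak 1)); first by rewrite mulr_ge0.
move=> b.
have rhs0 : 0 <= 2 * b ^+ 2 + 2 * (G / normal_peak 1).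
  by apply: addr_ge0; apply: mulr_ge0 => //; exact: sqr_ge0.
rewrite /hfun /gamma_quantile.
have [-> //|[]] := pinv_cases (fun=> 0) `[0, +oo[ (gamma_cdf a)
  (std_normal_cdf b).
set h := pinv_ _ _ _ _.
rewrite /= in_itv/= andbT le_eqVlt => /predU1P[<-//|h0] hE.
have : normal_peak 1 * expR (- (b ^+ 2 + 1)) <= G * expR (- h / 2).
  by rewrite (le_trans (std_normal_tail_ge b))// -hE gamma_cdf_tail_le.
rewrite mulrC -ler_pdivlMr// mulrAC -ler_pdivrMr ?expR_gt0//.
rewrite -expRN -expRD => /(le_trans (expR_ge1Dx _)).
lra.
Qed.

End GammaQuantileGrowth.
(** * Bounds on the germs and on the triangular factor *)

Section GermBound.
Context (R : realType) (k : nat) (chi : 'rV[R]_3 -> R)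
  (q : mindex k -> 'M[R]_(3, k) -> R).

Lemma sum_chiDt (y : 'M[R]_(3, k)) :
  0 < ampl_sqsum chi q y -> \sum_b chiDt chi q b y = 1.
Proof. by move=> s0; rewrite -mulr_suml divff// gt_eqF. Qed.

(** Cauchy-Schwarz between the weights, of total mass 2, and the amplitudes. *)
Lemma sqr_gnu_le (x : 'rV[R]_3) S (z phi : mindex k.*2 -> R) :
  0 < ampl_sqsum chi q S.2 -> gnu chi q x S z phi ^+ 2 <= 2 * \sum_b z b ^+ 2.
Proof.
move=> s0; rewrite /gnu; under eq_bigr do rewrite -mulrA.
apply: (le_trans (cauchy_schwarz_sum _ _)); apply: ler_pM.
- by apply: sumr_ge0 => b _; exact: sqr_ge0.
- by apply: sumr_ge0 => b _; exact: sqr_ge0.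
- rewrite -[leRHS]mulr1 -[X in _ <= _ * X](sum_chiDt s0) mulr_sumr.
  apply: ler_sum => b _; rewrite sqr_sqrtr// mulr_ge0//.
  by rewrite /chiDt mulr_ge0 ?sqr_ge0// invr_ge0 ltW.
- apply: ler_sum => b _; rewrite exprMn ler_piMr ?sqr_ge0//.
Qed.

End GermBound.

Section FactorBound.
Context (R : realType) (delta : R).

Lemma alphac_gt1 (m : 'I_6) :
  0 < delta < Num.sqrt (7 / 11) -> 1 < alphac delta m.
Proof.
move=> /andP[d0 d1]; rewrite /alphac /sigmac expr_div_n sqr_sqrtr//.
have d2 : delta ^+ 2 < 7 / 11.
  by rewrite -[ltRHS]sqr_sqrtr// ltr_pXn2r ?nnegrE ?sqrtr_ge0 ?ltW.
have m6 : (m.+1)%:R <= 6 :> R by rewrite ler_nat.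
have d20 : 0 < delta ^+ 2 by rewrite exprn_gt0.
have : 11 / 2 < 1 / (2 * (delta ^+ 2 / 7)).
  by rewrite ltr_pdivlMr ?mulr_gt0//; lra.
lra.
Qed.

Lemma hfun_alphac_le : 0 < delta < Num.sqrt (7 / 11) ->
  exists2 K, 0 <= K & forall m b, hfun b (alphac delta m) <= 2 * b ^+ 2 + K.
Proof.
move=> hdelta.
have /fin_all_exists[K hK] (m : 'I_6) : exists K, 0 <= K /\
    forall b, hfun b (alphac delta m) <= 2 * b ^+ 2 + K.
  by have [K K0 hK] := hfun_le (alphac_gt1 m hdelta); exists K.
exists (\sum_m K m) => [|m b]; first by apply: sumr_ge0 => m _; case: (hK m).
rewrite (bigD1 m)//= addrA (le_trans ((hK m).2 b))// lerDl.
by apply: sumr_ge0 => n _; case: (hK n).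
Qed.

(** Every entry of the factor has the same bound, hence 36 times it. *)
Lemma sqr_normF_Lmat_le (G : 'I_6 -> 'I_6 -> R) (K s : R) :
  0 <= K -> 0 <= s ->
  (forall m b, hfun b (alphac delta m) <= 2 * b ^+ 2 + K) ->
  (forall m n : 'I_6, (m <= n)%N -> G m n ^+ 2 <= 2 * s) ->
  normF (Lmat delta G) ^+ 2 <= 36 * (sigmac delta ^+ 2 * (8 * s + 2 * K)).
Proof.
move=> K0 s0 hK Gs; set bound := sigmac delta ^+ 2 * _.
have -> : 36 * bound = \sum_(m < 6) \sum_(n < 6) bound.
  by rewrite !sumr_const !card_ord -mulrnA -[RHS]mulr_natl.
rewrite sqr_normF.
apply: ler_sum => m _; apply: ler_sum => n _; rewrite mxE /bound.
have := Gs m n; case: ltngtP => [mn|nm|/val_inj <-] /=.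
- move=> /(_ isT) Gmn; rewrite exprMn ler_wpM2l ?sqr_ge0//; lra.
- by move=> _; rewrite -val_eqE gtn_eqF//= expr0n/= mulr_ge0 ?sqr_ge0//; lra.
rewrite eqxx => /(_ isT) Gmm; rewrite exprMn ler_wpM2l ?sqr_ge0//.
set h := hfun _ _; have hle : h <= 2 * (2 * s) + K.
  by apply: le_trans (hK _ _) _; rewrite lerD2r ler_wpM2l.
(* [Num.sqrt] is 0 on negative numbers *)
have [h0|h0] := leP 0 h; first by rewrite sqr_sqrtr; lra.
by rewrite ler0_sqrtr ?expr0n/=; lra.
Qed.

End FactorBound.
(** * Eighth moment of the amplitudes *)

Section AmplitudeMoments.
Context (R : realType).
Local Notation mu := (@lebesgue_measure R).

Lemma continuous_inv_sqrt (x : R) :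
  0 < x -> {for x, continuous (fun u : R => (Num.sqrt u)^-1)}.
Proof.
move=> x0; apply: cvgV; last exact: sqrt_continuous.
by rewrite gt_eqF// sqrtr_gt0.
Qed.

Lemma measurable_inv_sqrt (D : set R) : (forall x, D x -> 0 < x) ->
  measurable_fun D (fun u : R => (Num.sqrt u)^-1).
Proof.
move=> D0; apply: (@measurable_funS _ _ _ _ (`]0, +oo[%classic : set R)) => //.
  by move=> x /D0 /=; rewrite in_itv/= andbT.
apply: open_continuous_measurable_fun => // x.
by rewrite inE/= in_itv/= andbT; exact: continuous_inv_sqrt.
Qed.

(** On each [[e, 1]] the integral is [2 - 2 * Num.sqrt e], at most 2; monotone
convergence lets [e] tend to 0. *)
Lemma integral_inv_sqrt_lty :
  (\int[mu]_(u in `]0%R, 1%R]) ((Num.sqrt u)^-1)%:E < +oo)%E.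
Proof.
pose f (u : R) := (Num.sqrt u)^-1.
pose F (u : R) := 2 * Num.sqrt u.
have fF (x : R) : 0 < x -> is_derive x 1 F (f x).
  move=> x0; have dsqrt := is_derive1_sqrt x0.
  apply: is_derive_eq; rewrite /GRing.scale/= /f.
  by field; rewrite gt_eqF// sqrtr_gt0.
have int_le (e : R) : 0 < e -> e <= 1 ->
    (\int[mu]_(u in `[e, 1%R]) (f u)%:E <= 2%:E)%E.
  move=> e0; rewrite le_eqVlt => /predU1P[->|e1].
    by rewrite set_itv1 integral_set1.
  rewrite (@continuous_FTC2 _ _ F) //.
  - rewrite -EFinB lee_fin /F sqrtr1 mulr1 gerBl mulr_ge0 ?sqrtr_ge0//.
  - apply: continuous_in_subspaceT => x; rewrite inE/= in_itv/= => /andP[ex _].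
    by apply: continuous_inv_sqrt; exact: lt_le_trans ex.
  - have F_cont (x : R) : 0 < x -> {for x, continuous F}.
      move=> /fF[dF _].
      exact/differentiable_continuous/derivable1_diffP.
    split.
    + move=> x; rewrite in_itv/= => /andP[ex _].
      by case: (fF _ (lt_trans e0 ex)).
    + by apply: cvg_at_right_filter; exact: F_cont.
    + by apply: cvg_at_left_filter; exact: F_cont.
  - move=> x; rewrite in_itv/= => /andP[ex _].
    by rewrite derive1E; case: (fF _ (lt_trans e0 ex)).
rewrite itv_open_bnd_bigcup; apply: (@le_lt_trans _ _ 2%:E); last exact: ltry.
have e_gt0 n : 0 < 0 + n.+1%:R^-1 :> R by rewrite add0r invr_gt0.
pose I n := `[(0 + n.+1%:R^-1)%R, 1%R]%classic : set (measurableTypeR R).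
have nndI : nondecreasing_seq I.
  move=> m n mn; rewrite subsetEset; apply: subset_itvr.
  by rewrite bnd_simp lerD2l lef_pV2 ?posrE// ler_nat.
have mI n : measurable (I n) by exact: measurable_itv.
have mf n : measurable_fun (I n) (EFin \o f).
  apply/measurable_EFinP; apply: measurable_inv_sqrt.
  by move=> u; rewrite /I/= in_itv/= => /andP[/(lt_le_trans (e_gt0 n))].
have f0 n u : I n u -> (0 <= (EFin \o f) u)%E.
  by move=> _; rewrite lee_fin invr_ge0 sqrtr_ge0.
have /cvg_lim <- // := @ge0_nondecreasing_set_cvg_integral _ _ _ _ _
  mu nndI mI mf f0.
apply: lime_le.
  apply: ereal_nondecreasing_is_cvgn.
  exact: ge0_nondecreasing_set_nondecreasing_integral.
apply: nearW => n; apply: int_le => //.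
by rewrite add0r invf_le1// ler1n.
Qed.

(** With [t := - ln u] this is the fourth power of [t / 8 <= expR (t / 8)],
since [expR (t / 2)] is the inverse of [Num.sqrt u]. *)
Lemma ln_expn4_le (u : R) : 0 < u <= 1 ->
  (- ln u) ^+ 4 <= 8 ^+ 4 * (Num.sqrt u)^-1.
Proof.
move=> /andP[u0 u1]; set t := - ln u.
have t0 : 0 <= t by rewrite oppr_ge0 ln_le0.
have -> : (Num.sqrt u)^-1 = expR (t / 8) ^+ 4.
  have -> : Num.sqrt u = expR (- t / 2).
    rewrite -[LHS](_ : Num.sqrt (expR (- t / 2) ^+ 2) = _).
      by rewrite sqrtr_sqr ger0_norm ?expR_ge0.
    congr Num.sqrt; rewrite -expRM_natl -[RHS]lnK ?posrE//.
    by congr expR; rewrite /t; field.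
  by rewrite -expRN -expRM_natl; congr expR; field.
rewrite -exprMn lerXn2r ?nnegrE ?mulr_ge0 ?expR_ge0//.
rewrite mulrC -ler_pdivrMr//; apply: ltW.
by apply: lt_le_trans (expR_ge1Dx _); rewrite ltrDr.
Qed.

Lemma measurable_amplitude :
  measurable_fun [set: R] (fun u : R => Num.sqrt (- ln u)).
Proof.
have msqrt : measurable_fun [set: R] (@Num.sqrt R).
  apply: continuous_measurable_fun => x; exact: sqrt_continuous.
have mln : measurable_fun [set: R] (fun u : R => - ln u).
  exact: measurable_funN (@measurable_ln R).
exact: (measurableT_comp msqrt mln).
Qed.

Lemma amplitude_moment8_lty :
  (\int[uniform_prob (@ltr01 R)]_u (Num.sqrt (- ln u) ^+ 8)%:E < +oo)%E.
Proof.
have mf : measurable_fun [set: R] (fun u : R => (Num.sqrt (- ln u) ^+ 8)%:E).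
  apply/measurable_EFinP; apply: measurable_funX.
  exact: measurable_amplitude.
rewrite integral_uniform//.
rewrite subr0 invr1 mul1e -integral_itv_obnd_cbnd; last exact: measurable_funTS.
have mg : measurable_fun (`]0, 1]%classic : set R)
    (fun u : R => ((Num.sqrt u)^-1)%:E).
  apply/measurable_EFinP; apply: measurable_inv_sqrt => u /=.
  by rewrite in_itv/= => /andP[].
apply: (@le_lt_trans _ _
  (\int[mu]_(u in `]0%R, 1%R]) ((8 ^+ 4)%:E * ((Num.sqrt u)^-1)%:E))%E).
  apply: ge0_le_integral => //=.
  - exact: measurable_funTS.
  - exact: measurable_funeM.
  move=> u; rewrite in_itv/= => u01; rewrite -EFinM lee_fin.
  rewrite (exprM _ 2 4) sqr_sqrtr; first exact: ln_expn4_le.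
  by case/andP: u01 => _ u1; rewrite oppr_ge0 ln_le0.
rewrite ge0_integralZl//.
by rewrite lte_mul_pinfty// integral_inv_sqrt_lty.
Qed.

Context d (T : measurableType d) (P : probability T R).

(** Transfers the eighth moment from the uniform law to the amplitude: its law
agrees on measurable sets with the image of the uniform law under
[u |-> Num.sqrt (- ln u)], which is all that an integral sees. *)
Lemma amplitude_sqr_Lfun4 (Z : {RV P >-> R}) :
  has_law Z (@amplitude_law R) -> (fun t => Z t ^+ 2) \in Lfun P 4%:E.
Proof.
move=> lawZ.
have mZ2 : measurable_fun [set: T] (fun t => Z t ^+ 2).
  by apply: measurable_funX.
rewrite inE; apply/andP; split; rewrite inE//=.
rewrite /finite_norm unlock /Lnorm/= poweR_lty//.
under eq_integral => t _.
  rewrite powR_mulrn//.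
  have -> : `|Z t ^+ 2| ^+ 4 = Z t ^+ 8 by rewrite ger0_norm ?sqr_ge0// -exprM.
  over.
rewrite -(@ge0_integral_distribution _ _ _ _ _ P Z
  (fun z : R => (z ^+ 8)%:E)); last 2 first.
- by apply/measurable_EFinP; exact: exprn_measurable.
- by move=> z; rewrite lee_fin; apply: exprn_even_ge0.
pose phi : measurableTypeR R -> R := fun u => Num.sqrt (- ln u).
have mphi : measurable_fun [set: _] phi.
  exact: measurable_amplitude.
pose X : {RV (uniform_prob (@ltr01 R)) >-> R} :=
  mfun_Sub (mem_set mphi).
rewrite (eq_measure_integral (distribution (uniform_prob (@ltr01 R)) X)).
  rewrite ge0_integral_distribution//; first exact: amplitude_moment8_lty.
  - by apply/measurable_EFinP; exact: exprn_measurable.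
  - by move=> z; rewrite lee_fin; apply: exprn_even_ge0.
by move=> A mA _; exact: lawZ mA.
Qed.

End AmplitudeMoments.
(** * The dominating random variable *)

Section DominatingVariable.
Context d (T : measurableType d) (R : realType) (P : probability T R) (k : nat).
Implicit Types Z : 'I_6 -> 'I_6 -> mindex k.*2 -> {RV P >-> R}.

Definition germ_energy Z (t : T) : R :=
  \sum_(p : 'I_6 * 'I_6 | (p.1 <= p.2)%N) \sum_b Z p.1 p.2 b t ^+ 2.

Lemma germ_energy_ge0 Z t : 0 <= germ_energy Z t.
Proof.
by apply: sumr_ge0 => p _; apply: sumr_ge0 => b _; exact: sqr_ge0.
Qed.

Lemma sum_sqr_le_germ_energy Z (m n : 'I_6) t : (m <= n)%N ->
  \sum_b Z m n b t ^+ 2 <= germ_energy Z t.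
Proof.
move=> mn; rewrite /germ_energy (bigD1 (m, n))//= lerDl.
by apply: sumr_ge0 => p _; apply: sumr_ge0 => b _; exact: sqr_ge0.
Qed.

Lemma Lfun_bigsum (p : R) (I : finType) (Q : pred I) (f : I -> T -> R) :
  1 <= p -> (forall i, Q i -> f i \in Lfun P p%:E) ->
  (fun t => \sum_(i | Q i) f i t) \in Lfun P p%:E.
Proof.
move=> p1 fp; have p1E : (1 <= p%:E)%E by rewrite lee_fin.
have [L0 LD] := Lfun_addr_closed P p1E.
rewrite (_ : (fun t => _) = \sum_(i | Q i) f i).
  exact: (big_ind (fun g => g \in Lfun P p%:E)).
by apply/funext => t; rewrite fct_sumE.
Qed.

Lemma germ_energy_Lfun4 Z :
  (forall (m n : 'I_6) b, (m <= n)%N -> has_law (Z m n b) (@amplitude_law R)) ->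
  germ_energy Z \in Lfun P 4%:E.
Proof.
move=> lawZ; apply: Lfun_bigsum => [|p mn]; first by rewrite ler1n.
apply: Lfun_bigsum => [|b _]; first by rewrite ler1n.
exact/amplitude_sqr_Lfun4/lawZ.
Qed.

Lemma Lfun_expectation_expn_lty (X : T -> R) (n : nat) : (0 < n)%N ->
  (forall t, 0 <= X t) -> X \in Lfun P n%:R%:E ->
  ('E_P[(fun t => X t ^+ n)%R] < +oo)%E.
Proof.
move=> n0 X0 /Lfun_integrable; rewrite ler1n => /(_ n0) /integrable_lty.
rewrite unlock; under eq_integral do rewrite powR_mulrn// ger0_norm//.
exact.
Qed.

End DominatingVariable.

Theorem corollary1 (R : realType)
    (d : measure_display) (Theta : measurableType d) (P : probability Theta R)
    (Cbar Lbar : 'M[R]_6) (c0 c1 eps : R)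
    (hCbar : sym_posdef Cbar)
    (hc0 : 0 < c0) (hc1 : 0 < c1)
    (htr : \tr Cbar = c1)
    (hcoer : forall w : 'cV[R]_6, c0 * norm2 w ^+ 2 <= inner2 (Cbar *m w) w)
    (hLbar : upper_trig Lbar) (hChol : Cbar = Lbar^T *m Lbar)
    (heps : 0 < eps)
    (k : nat) (hk : (0 < k)%N)
    (chi : 'rV[R]_3 -> R) (hchi : spectral_density chi)
    (eps_s : R) (heps_s : 0 < eps_s < 1)
    (hnus : `| \sum_(b : mindex k.*2) chiD chi b - 1 | <= eps_s)
    (delta_s : R) (hdelta_s : 0 < delta_s)
    (q : R -> mindex k -> 'M[R]_(3, k) -> R)
    (hq_cont : forall b, {within @Cy R k, continuous (q delta_s b)})
    (hq_mid : forall b, q delta_s b (ymid R k) = 1)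
    (hq_pos : forall y, Cy y -> 0 < ampl_sqsum chi (q delta_s) y)
    (wmin wmax : 'rV[R]_3)
    (hw : forall j, 0 < wmin 0 j < wmax 0 j)
    (Z Phi : 'I_6 -> 'I_6 -> mindex k.*2 -> {RV P >-> R})
    (hgerm : germ_variables Z Phi)
    (delta_c : R) (hdelta_c : 0 < delta_c < Num.sqrt (7 / 11)) :
  let CC := elasticity_field chi (q delta_s) Z Phi delta_c eps Lbar in
  let c_eps := c0 * (eps / (1 + eps)) in
  0 < c_eps /\
  exists Gam : {RV P >-> R},
    [/\ forall t, 0 <= Gam t,
        ('E_P[(fun t => Gam t ^+ 2)%R] < +oo)%E,
        ('E_P[(fun t => Gam t ^+ 4)%R] < +oo)%E,
        forall S, CS wmin wmax S ->
          forall (w : 'cV[R]_6) (x : 'rV[R]_3), w != 0 ->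
          {ae P, forall t,
             inner2 (CC x S t *m w) w / norm2 w ^+ 2 <= normF (CC x S t)
               <= Gam t} &
        forall S, CS wmin wmax S -> forall x : 'rV[R]_3,
          (forall w w' : 'cV[R]_6,
             {ae P, forall t,
                `| inner2 (CC x S t *m w) w' | <= Gam t * norm2 w * norm2 w'})
          /\
          (forall w : 'cV[R]_6,
             {ae P, forall t,
                c_eps * norm2 w ^+ 2 <= inner2 (CC x S t *m w) w})].

Proof.
move=> CC c_eps.
have [lawZ _ _] := hgerm.
split; first by rewrite mulr_gt0// divr_gt0// addr_gt0.
have [K K0 hK] := hfun_alphac_le hdelta_c.
pose Lfactor S x t := Lmat delta_c (Gnu chi (q delta_s) Z Phi x S t).
have CCE S x t :
    CC x S t = elasticity eps Lbar ((Lfactor S x t)^T *m Lfactor S x t).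
  by [].
pose sig := sigmac delta_c ^+ 2.
(* [A] and [B] collect the constant and the linear part of the bound of
   [normF_elasticity_le] once [sqr_normF_Lmat_le] is inserted. *)
pose A := normF Lbar ^+ 2 *
  (eps * normF (1%:M : 'M[R]_6) + 36 * (sig * (2 * K))).
pose B := normF Lbar ^+ 2 * (36 * (sig * 8)).
have Lbar2_ge0 : 0 <= normF Lbar ^+ 2 by exact: sqr_ge0.
have sig_ge0 : 0 <= sig by exact: sqr_ge0.
have A0 : 0 <= A.
  apply: mulr_ge0 => //; apply: addr_ge0.
    by rewrite mulr_ge0 ?normF_ge0 ?ltW.
  by do 3 apply: mulr_ge0 => //.
have B0 : 0 <= B by do 3 apply: mulr_ge0 => //.
pose Gam t := A + germ_energy Z t * B.
have Gam0 t : 0 <= Gam t.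
  by apply: addr_ge0 => //; apply: mulr_ge0 => //; exact: germ_energy_ge0.
have Gam4 : Gam \in Lfun P 4%:E.
  have [_ LD] := Lfun_addr_closed P (lee1n 4).
  apply: (LD (cst A) (B \o* germ_energy Z)).
    by apply: Lfun_cst.
  by apply: Lfun_scale; [rewrite ler1n|exact: germ_energy_Lfun4].
have Gam2 : Gam \in Lfun P 2%:E.
  move: Gam4; apply: Lfun_subset; rewrite ?lee_fin ?ler1n ?ler_nat//.
  exact: fin_num_measure.
have CC_le S : CS wmin wmax S -> forall x t, normF (CC x S t) <= Gam t.
  move=> [_ yS] x t; rewrite CCE.
  apply: (le_trans (normF_elasticity_le _ heps _)).
  have L_le : normF (Lfactor S x t) ^+ 2 <=
      36 * (sig * (8 * germ_energy Z t + 2 * K)).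
    apply: sqr_normF_Lmat_le => //; first exact: germ_energy_ge0.
    move=> m n mn; apply: (le_trans (sqr_gnu_le _ _ _ (hq_pos _ yS))).
    by rewrite ler_wpM2l// sum_sqr_le_germ_energy.
  have -> : Gam t = normF Lbar ^+ 2 * (eps * normF (1%:M : 'M[R]_6) +
      36 * (sig * (8 * germ_energy Z t + 2 * K))) by rewrite /Gam /A /B; ring.
  by rewrite ler_wpM2l ?sqr_ge0// lerD2l.
exists (mfun_Sub (sub_Lfun_mfun Gam4)); split.
- exact: Gam0.
- exact: Lfun_expectation_expn_lty.
- exact: Lfun_expectation_expn_lty.
- move=> S hS w x w0; apply: nearW => t; rewrite CC_le// andbT.
  rewrite ler_pdivrMr ?exprn_gt0 ?norm2_gt0// expr2 mulrA.
  exact: le_trans (ler_norm _) (inner2_mulmx_le _ _ _).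
- move=> S hS x; split=> [w w'|w]; apply: nearW => t.
    apply: (le_trans (inner2_mulmx_le _ _ _)).
    by rewrite -!mulrA ler_wpM2r ?mulr_ge0 ?norm2E ?normF_ge0// CC_le.
  by rewrite CCE; apply: elasticity_coercive => //; rewrite -hChol.
Qed.
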